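(* Let $F_{p,X}[h^{-1},h]$ be the VOA generated by $D$ $\beta$-$\gamma$ systems $p_i(z),X^i(z)$ ($i=1,\dots,D$), let $\mathcal F$ be its rescaled complex of light modes and $\mu_0,\{\cdot,\cdot\}_0$ the quasiclassical Lian–Zuckerman operations. Identify $V^0=\mathcal O_M$ and $V^1=TM\oplus T^*M$ for $M=\mathrm{Spf}(\mathbb C[[X_0^1,\dots,X_0^D]])$. Then the homotopy BV algebra on $\mathcal F$ generated by $\mu_0$ and $\{\cdot,\cdot\}_0$ contains the Courant algebroid structure on $TM\oplus T^*M$, i.e.: (a) $\{\cdot,\cdot\}_0$ restricted to $TM\oplus T^*M\subset\mathcal F_1$ coincides with the Dorfman bracket $$((\mathbf A_1,\mathbf B_1),(\mathbf A_2,\mathbf B_2))_D=(L_{\mathbf A_1}\mathbf A_2,\ L_{\mathbf A_1}\mathbf B_2-i_{\mathbf A_2}d\mathbf B_1);$$ (b) $\mu_0:\mathcal F_0\otimes(TM\oplus T^*M)\to TM\oplus T^*M$ is the multiplication of an element of $TM\oplus T^*M$ by a function; (c) the natural pairing $\langle(\mathbf A_1,\mathbf B_1),(\mathbf A_2,\mathbf B_2)\rangle=\sum_k(A_1^kB_{2,k}+B_{1,k}A_2^k)$ is given by the operator product coefficient, namely it equals $-\lim_{h\to0}h^{-1}\mathrm{Res}_z\big(z\,\mathcal X_1(z)\mathcal X_2\big)$ for $\mathcal X_i=(\mathbf A_i,\mathbf B_i)$.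
   Context: **$\beta$-$\gamma$ VOA.** $X^i(z)=\sum_nX^i_nz^{-n}$, $p_i(z)=\sum_np_{i,n}z^{-n-1}$, $[X^i_n,p_{j,m}]=h\delta_{ij}\delta_{n,-m}$, other commutators zero, i.e. $X^i(z)p_j(w)\sim\frac{h\delta_{ij}}{z-w}$, $X^iX^j\sim0$, $p_ip_j\sim0$. The underlying space is $V[h^{-1},h]$ with $V=F_{p,X}=\mathbb C[[X_0^1,\dots,X_0^D]]\otimes\mathbb C[p_{i,-n},X^i_{-n}]_{n>0}$ (vacuum annihilated by $p_{i,n}$, $n\ge0$, and $X^i_n$, $n>0$), Virasoro field $L(z)=-\frac1h\sum_i{:}p_i\partial X^i{:}$. Weight $0$ states of $V$ are power series $u(X)$; weight $1$ states are $\mathbf A+\mathbf B$ with operators $\sum_i{:}A^i(X)p_i{:}(z)$ and $\sum_jB_j(X)\partial X^j(z)$; these are identified with functions, vector fields $\mathbf A=\sum A^i\partial_i$ and 1-forms $\mathbf B=\sum B_jdX^j$ on $M$ (so $TM$, $T^*M$, $\mathcal O_M$ denote the spaces of sections). **Ghosts.** $\Lambda$ is the Fock module of $\{b_n,c_m\}=\delta_{n+m,0}$ with vacuum $\mathbf 1$, $c_k\mathbf 1=0$ for $k\ge2$, $b_k\mathbf 1=0$ for $k\ge-1$; $b(z)=\sum b_mz^{-m-2}$, $c(z)=\sum c_nz^{-n+1}$. Ghost number $|a|$ counts $c$ with $+1$, $b$ with $-1$. Inside $V[h]\otimes\Lambda$, writing states via their operators: $\mathcal F_0=V^0$, $\mathcal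 F_1=cV^1\oplus h\,\partial c\,V^0$, $\mathcal F_2=h\,c\,\partial c\,V^1\oplus h\,c\,\partial^2c\,V^0$, $\mathcal F_3=h^2c\,\partial c\,\partial^2c\,V^0$. The copy of $TM\oplus T^*M$ in $\mathcal F_1$ is $cV^1$. **Operations.** $\mu(a_1,a_2)=\mathrm{Res}_z\frac{a_1(z)a_2}{z}$ and $\{a_1,a_2\}=(-1)^{|a_1|}\mathrm{Res}_z(b_{-1}a_1)(z)a_2$; on $\mathcal F$, $\mu=\mu_0+O(h)$ and $\{\cdot,\cdot\}=h\{\cdot,\cdot\}_0+O(h^2)$. *)

(* Defs.v *)
From HB Require Import structures.
From mathcomp Require Import all_boot all_order all_algebra.
From mathcomp Require Import finmap monalg.
From mathcomp Require Import boolp classical_sets fsbigop.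
From mathcomp Require mpoly.

Set Implicit Arguments.
Unset Strict Implicit.
Unset Printing Implicit Defensive.

Import GRing.Theory.
Local Open Scope ring_scope.
Local Open Scope classical_set_scope.

(* K[[X_1, ..., X_D]] *)
Record fps (D : nat) (K : fieldType) := Fps { fcoef : mpoly.multinom D -> K }.

Section Fps.
Import mpoly.
Variables (D : nat) (K : fieldType).
Local Notation R := (fps D K).
Implicit Types (u v w : R) (m : 'X_{1..D}).

Lemma fpsP u v : (forall m, fcoef u m = fcoef v m) -> u = v.
Proof. by case: u v => [u] [v] /= e; congr Fps; apply/funext. Qed.

HB.instance Definition _ := gen_eqMixin R.
HB.instance Definition _ := gen_choiceMixin R.

Definition fps_zero : R := Fps (fun=> 0).
Definition fps_opp u : R := Fps (fun m => - fcoef u m).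
Definition fps_add u v : R := Fps (fun m => fcoef u m + fcoef v m).

Lemma fps_addA : associative fps_add.
Proof. by move=> u v w; apply: fpsP => m /=; rewrite addrA. Qed.
Lemma fps_addC : commutative fps_add.
Proof. by move=> u v; apply: fpsP => m /=; rewrite addrC. Qed.
Lemma fps_add0 : left_id fps_zero fps_add.
Proof. by move=> u; apply: fpsP => m /=; rewrite add0r. Qed.
Lemma fps_addN : left_inverse fps_zero fps_opp fps_add.
Proof. by move=> u; apply: fpsP => m /=; rewrite addNr. Qed.

HB.instance Definition _ :=
  GRing.isZmodule.Build R fps_addA fps_addC fps_add0 fps_addN.

Definition fpsC (a : K) : R := Fps (fun m => a *+ (m == 0%MM)).
Definition fpsX (i : 'I_D) : R := Fps (fun m => (m == U_(i)%MM)%:R).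

Definition fps_mul u v : R := Fps (fun m =>
  \sum_(k : 'X_{1..D < (mdeg m).+1, (mdeg m).+1} | m == (k.1 + k.2)%MM)
     fcoef u k.1 * fcoef v k.2).

Definition fps_trunc (d : nat) u : mpoly D K :=
  \sum_(m : 'X_{1..D < d}) fcoef u m *: 'X_[m].

Lemma fps_truncE d u m :
  (mdeg m < d)%N -> (fps_trunc d u)@_m = fcoef u m.
Proof.
move=> lt_m; rewrite /fps_trunc linear_sum /= (bigD1 (BMultinom lt_m)) //=.
rewrite mcoeffZ mcoeffX eqxx mulr1 big1 ?addr0 // => k /eqP ne_k.
rewrite mcoeffZ mcoeffX; case: eqP => [e|_]; last by rewrite mulr0.
by case: ne_k; apply/val_inj.
Qed.

Lemma fps_mulE u v m (p q : mpoly D K) :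
    (forall k, (mdeg k <= mdeg m)%N -> p@_k = fcoef u k) ->
    (forall k, (mdeg k <= mdeg m)%N -> q@_k = fcoef v k) ->
  fcoef (fps_mul u v) m = (p * q)@_m.
Proof.
move=> ep eq; rewrite mcoeffM /=; apply: eq_bigr => -[k l] /= _.
by rewrite ep ?eq // -ltnS bmdeg.
Qed.

Lemma fps_mul_truncE u v m d : (mdeg m < d)%N ->
  fcoef (fps_mul u v) m = (fps_trunc d u * fps_trunc d v)@_m.
Proof.
by move=> lt_m; apply: fps_mulE => k le_k;
  rewrite fps_truncE // (leq_ltn_trans le_k).
Qed.

Lemma fps_mulC : commutative fps_mul.
Proof.
by move=> u v; apply: fpsP => m; rewrite !(@fps_mul_truncE _ _ m _ (ltnSn _)) mulrC.
Qed.

Lemma fps_mulA : associative fps_mul.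
Proof.
move=> u v w; apply: fpsP => m; set d := (mdeg m).+1.
have tr (a : R) k : (mdeg k <= mdeg m)%N -> (fps_trunc d a)@_k = fcoef a k.
  by move=> le_k; rewrite fps_truncE.
have trM (a b : R) k : (mdeg k <= mdeg m)%N ->
    (fps_trunc d a * fps_trunc d b)@_k = fcoef (fps_mul a b) k.
  by move=> le_k; rewrite (@fps_mul_truncE _ _ _ d).
rewrite (fps_mulE (tr u) (trM v w)) (fps_mulE (trM u v) (tr w)).
by rewrite mulrA.
Qed.

Lemma fps_mul1 : left_id (fpsC 1) fps_mul.
Proof.
move=> u; apply: fpsP => m.
rewrite (@fps_mulE _ _ _ 1 (fps_trunc (mdeg m).+1 u)).
- by rewrite mul1r fps_truncE.
- by move=> k _; rewrite mcoeff1 /=; case: eqP.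
- by move=> k le_k; rewrite fps_truncE.
Qed.

Lemma fps_mulDl : left_distributive fps_mul fps_add.
Proof.
move=> u v w; apply: fpsP => m /=; rewrite -big_split /=.
by apply: eq_bigr => k _; rewrite mulrDl.
Qed.

Lemma fps_1neq0 : fpsC 1 != 0 :> R.
Proof.
apply/eqP => /(congr1 (fun u => fcoef u 0%MM)) /= /eqP.
by rewrite eqxx oner_eq0.
Qed.

HB.instance Definition _ := GRing.Zmodule_isComNzRing.Build R
  fps_mulA fps_mulC fps_mul1 fps_mulDl fps_1neq0.

Definition fps_partial (i : 'I_D) u : R :=
  Fps (fun m => fcoef u (m + U_(i))%MM *+ (m i).+1).

End Fps.

Section Geometry.
Variables (D : nat) (K : fieldType).
Local Notation R := (fps D K).

(* On M = Spf K[[X_1, ..., X_D]]: A = sum_i A 0 i * d/dX_i and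
   B = sum_i B 0 i * dX_i. *)
Definition vfield := 'rV[R]_D.
Definition oneform := 'rV[R]_D.

(* TM (+) T*M, with its componentwise module structure over O_M *)
Definition gsection := (vfield * oneform)%type.

Implicit Types (A : vfield) (B : oneform).

Definition lie_vfield A A' : vfield :=
  \row_i \sum_j (A 0 j * fps_partial j (A' 0 i) - A' 0 j * fps_partial j (A 0 i)).

Definition lie_oneform A B : oneform :=
  \row_i \sum_j (A 0 j * fps_partial j (B 0 i) + B 0 j * fps_partial i (A 0 j)).

(* (dB)_ij, for dB = 1/2 sum_ij (dB)_ij dX_i /\ dX_j *)
Definition ext_deriv B : 'M[R]_D :=
  \matrix_(i, j) (fps_partial i (B 0 j) - fps_partial j (B 0 i)).

Definition contract A (w : 'M[R]_D) : oneform := \row_j \sum_i A 0 i * w i j.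

Definition dorfman (x y : gsection) : gsection :=
  (lie_vfield x.1 y.1,
   lie_oneform x.1 y.2 - contract y.1 (ext_deriv x.2)).

Definition pairing (x y : gsection) : R :=
  \sum_k (x.1 0 k * y.2 0 k + x.2 0 k * y.1 0 k).

End Geometry.

(* Creation operators other than X^i_0:
     inl (i, k) is p_{i,-k-1},  inr (i, k) is X^i_{-k-1};
     inl k      is b_{-k-2},    inr k      is c_{1-k}.       *)
Definition osc (D : nat) := ('I_D * nat + 'I_D * nat)%type.
Definition ghost := (nat + nat)%type.

(* (e, m, s) labels h^e times the monomial m in the oscillators times the
   product of the elements of s, taken in the order ghost_le, applied to the
   vacuum. *)
Definition label (D : nat) := (int * {cmonom (osc D)} * {fset ghost})%type.

(* Finite linear combinations of labels with coefficients in K[[X_0]]. *)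
Notation state D K := {malg (fps D K)[label D]}.

Definition ghost_le (x y : ghost) : bool :=
  match x, y with
  | inl j, inl k | inr j, inr k => (j <= k)%N
  | inl _, inr _ => true
  | inr _, inl _ => false
  end.

Section Operators.
Variables (D : nat) (K : fieldType).
Local Notation R := (fps D K).
Local Notation S := (state D K).
Implicit Types (x v : S) (u : R) (l : label D) (i : 'I_D) (n : int).

Definition vac : S := << 1 *g ((0, onecm _, fset0) : label D) >>.

Definition lift (f : label D -> R -> S) x : S := \sum_(l <- msupp x) f l x@_l.

Definition hmul (e : int) : S -> S :=
  lift (fun l u => << u *g ((l.1.1 + e, l.1.2, l.2) : label D) >>).

Definition osc_mul (g : osc D) : S -> S :=
  lift (fun l u => << u *g ((l.1.1, mulcm l.1.2 (ucm g), l.2) : label D) >>).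

Definition osc_deriv (g : osc D) : S -> S :=
  lift (fun l u => << u *+ l.1.2 g *g ((l.1.1, divcm l.1.2 (ucm g), l.2) : label D) >>).

Definition zero_deriv i : S -> S := lift (fun l u => << fps_partial i u *g l >>).

(* X^i_n and p_{i,n}, with [X^i_n, p_{j,m}] = h delta_ij delta_{n,-m} *)
Definition Xmode i n v : S :=
  match n with
  | Posz 0 => fpsX K i *: v
  | Posz k.+1 => hmul 1 (osc_deriv (inl (i, k)) v)
  | Negz k => osc_mul (inr (i, k)) v
  end.

Definition pmode i n v : S :=
  match n with
  | Posz 0 => - hmul 1 (zero_deriv i v)
  | Posz k.+1 => - hmul 1 (osc_deriv (inr (i, k)) v)
  | Negz k => osc_mul (inl (i, k)) v
  end.

(* sign for moving g to its place in s *)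
Definition ghost_sign (g : ghost) (s : {fset ghost}) : R :=
  (-1) ^+ #|` [fset g' in s | ghost_le g' g && (g' != g)]%fset |.

Definition ghost_mul (g : ghost) : S -> S :=
  lift (fun l u => if g \in l.2 then 0 else
    << ghost_sign g l.2 * u *g ((l.1, (g |` l.2)%fset) : label D) >>).

Definition ghost_deriv (g : ghost) : S -> S :=
  lift (fun l u => if g \in l.2 then
    << ghost_sign g l.2 * u *g ((l.1, (l.2 `\ g)%fset) : label D) >> else 0).

(* b_n and c_n, with {b_n, c_m} = delta_{n,-m} *)
Definition bmode n v : S :=
  match n with
  | Posz k => ghost_deriv (inr k.+1) v
  | Negz 0 => ghost_deriv (inr 0%N) v
  | Negz k.+1 => ghost_mul (inl k) v
  end.

Definition cmode n v : S :=
  match n with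
  | Posz 0 => ghost_mul (inr 1%N) v
  | Posz 1 => ghost_mul (inr 0%N) v
  | Posz k.+2 => ghost_deriv (inl k) v
  | Negz k => ghost_mul (inr k.+2) v
  end.

(* a : field stands for a(z) = sum_n (a n) z^(-n-1); thus
   Res_z z^k a(z) v = a k v. *)
Definition field := int -> S -> S.

Definition Xfield i : field := fun n => Xmode i (n + 1).
Definition pfield i : field := fun n => pmode i n.
Definition bfield : field := fun n => bmode (n - 1).
Definition cfield : field := fun n => cmode (n + 2).

Definition dfield (a : field) : field := fun n v => a (n - 1) v *~ (- n).

(* (d/dz)^k a(z) / k! *)
Definition ddfield (k : nat) (a : field) : field := fun n v =>
  fpsC D (k`!%:R^-1 : K) *: iter k dfield a n v.

(* :a(z)b(z): = a_-(z) b(z) + (-1)^(|a||b|) b(z) a_+(z), where a_+ consists of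
   the modes a n with n >= 0; odd tells whether a and b are both odd. The sum
   has finitely many nonzero terms when a and b are fields. *)
Definition normal_prod (odd : bool) (a b : field) : field := fun n v =>
  \sum_(j \in [set: nat])
     (a (- 1 - j%:Z) (b (n + j%:Z) v)
      + (-1) ^+ odd *: b (n - 1 - j%:Z) (a j%:Z v)).

(* u(X(z)), by Taylor expansion at X_0: with X(z) - X_0 = sum_(m != 0) X_m z^-m,
     u(X(z)) = sum_k 1/k! sum_(i_1..i_k) (d_(i_1)..d_(i_k) u)(X_0)
                                        prod_j (X^(i_j)(z) - X^(i_j)_0),
   whose coefficient at z^(-n-1) is a sum over sequences of pairs (i_j, m_j)
   with m_j != 0 and sum_j m_j = n + 1; all the X^i_m commute. Applied to a
   given state it has finitely many nonzero terms. *)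
Definition fun_field (u : R) : field := fun n v =>
  \sum_(s \in [set s : seq ('I_D * int) |
                all (fun t => t.2 != 0) s /\ \sum_(t <- s) t.2 = n + 1])
    (fpsC D ((size s)`!%:R^-1 : K) * foldr (fun t => fps_partial t.1) u s)
      *: foldr (fun t => Xmode t.1 t.2) v s.

Definition osc_field (g : osc D) : field :=
  match g with
  | inl (i, k) => ddfield k (pfield i)
  | inr (i, k) => ddfield k.+1 (Xfield i)
  end.

Definition ghost_field (g : ghost) : field :=
  match g with
  | inl k => ddfield k bfield
  | inr k => ddfield k cfield
  end.

Definition matter_field (m : {cmonom (osc D)}) (u : R) : field :=
  foldr (fun g => normal_prod false (osc_field g)) (fun_field u)
    (flatten [seq nseq (m g) g | g <- (finsupp m : seq (osc D))]).

(* The boolean component is the parity of the product built so far. *)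
Definition term_field (l : label D) (u : R) : field :=
  (foldr (fun g (pa : bool * field) =>
            (~~ pa.1, normal_prod pa.1 (ghost_field g) pa.2))
     (false, matter_field l.1.2 u)
     (sort ghost_le (l.2 : seq ghost))).2.

(* x |-> x(z); h is central *)
Definition Y (x : S) : field := fun n v =>
  lift (fun l u => hmul l.1.1 (term_field l u n v)) x.

(* L(z) = - 1/h sum_i :p_i dX^i:, L_n being the coefficient of z^(-n-2) *)
Definition Lfield : field := fun n v =>
  - hmul (-1) (\sum_i normal_prod false (pfield i) (dfield (Xfield i)) n v).
Definition Lmode (n : int) : S -> S := Lfield (n + 1).

(* inV, inVh and weight k are V, V[h] and V^k; Fh is F[h]. *)
Definition inV : set S := [set x | forall l, l \in msupp x ->
  l.1.1 = 0 /\ l.2 = fset0].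

Definition inVh : set S := [set x | forall l, l \in msupp x ->
  (0 <= l.1.1)%R /\ l.2 = fset0].

Definition weight (k : int) : set S := [set x | inV x /\ Lmode 0 x = x *~ k].

(* F_0, ..., F_3. For v in V[h], the states of c v, dc v and d^2c v are
   c_1 v, c_0 v and 2 c_{-1} v. *)
Definition F0 : set S := weight 0.
Definition F1 : set S := [set x | exists v v0, [/\ weight 1 v, weight 0 v0 &
  x = cmode 1 v + hmul 1 (cmode 0 v0)]].
Definition F2 : set S := [set x | exists v v0, [/\ weight 1 v, weight 0 v0 &
  x = hmul 1 (cmode 1 (cmode 0 v)) + hmul 1 (cmode 1 (cmode (-1) v0 *+ 2))]].
Definition F3 : set S := [set x | exists2 v0, weight 0 v0 &
  x = hmul 2 (cmode 1 (cmode 0 (cmode (-1) v0 *+ 2)))].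
Definition F : set S := [set x | exists x0 x1 x2 x3,
  [/\ F0 x0, F1 x1, F2 x2, F3 x3 & x = x0 + x1 + x2 + x3]].

Definition Fh : set S := [set x | exists2 s : seq S,
  (forall y, y \in s -> F y) & x = \sum_(k < size s) hmul k%:Z s`_k].

(* a |-> (-1)^|a| a; the ghost number of a product of b's and c's has the
   parity of the number of factors *)
Definition ghost_parity : S -> S :=
  lift (fun l u => << (-1) ^+ #|` l.2| * u *g l >>).

Definition mu (x y : S) : S := Y x (-1) y.
Definition bracket (x y : S) : S := Y (bmode (-1) (ghost_parity x)) 0 y.

(* r is in F and x = h^k r + O(h^(k+1)) in F[h] *)
Definition leading (k : nat) (x r : S) : Prop :=
  F r /\ exists2 y, Fh y & x = hmul k%:Z r + hmul k.+1%:Z y.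

(* mu = mu0 + O(h) and {.,.} = h {.,.}_0 + O(h^2) *)
Definition mu0 (x y : S) : S := xget 0 (leading 0 (mu x y)).
Definition bracket0 (x y : S) : S := xget 0 (leading 1 (bracket x y)).

(* x is in V[h], with value r in V at h = 0 *)
Definition hlim (x r : S) : Prop :=
  inV r /\ exists2 y, inVh y & x = r + hmul 1 y.

(* O_M = V^0 and TM (+) T*M = V^1: u |-> u(X_0) vac and
   (A, B) |-> sum_i A_i(X_0) p_{i,-1} vac + sum_j B_j(X_0) X^j_{-1} vac *)
Definition fun_state (u : R) : S := u *: vac.

Definition section_state (X : gsection D K) : S :=
  \sum_i pmode i (-1) (fun_state (X.1 0 i))
  + \sum_j Xmode j (-1) (fun_state (X.2 0 j)).

(* the copy c V^1 of TM (+) T*M in F_1 *)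
Definition section_F1 (X : gsection D K) : S := cmode 1 (section_state X).

End Operators.

(* Main.v *)
(* The zeroth and first products of weight 1 states involve only finitely many
   modes: those p_n and X_n with n > 0 that do not kill weight 1 states have
   n = 1, and in u(X(z)) a sequence of modes X_m contributes only if the sum of
   its positive indices is at most 1. This gives the products as a leading
   power of h times the classical formula plus a single correction with one more
   power of h. The leading coefficients mu_0 and {.,.}_0 are well
   defined because in F the power of h is the number of ghosts other than c_1,
   so that F and h F[h] meet only in 0. *)

From HB Require Import structures.
From mathcomp Require Import all_boot all_order all_algebra.
From mathcomp Require Import finmap monalg reals complex.
From mathcomp Require Import boolp classical_sets fsbigop.
From mathcomp Require Import zify.
Require Import Defs.

Set Implicit Arguments.
Unset Strict Implicit.
Unset Printing Implicit Defensive.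

Import GRing.Theory.
Local Open Scope ring_scope.

(** * Identities in abelian groups, commutative monomials and monoid algebras *)

Lemma add0r_pair (V : zmodType) (a b : V) : 0 + a + (0 + b) = a + b.
Proof. by rewrite !add0r. Qed.

Lemma subr_swap (V : zmodType) (a b c d : V) : a + b = c + d -> a - c = d - b.
Proof. by move=> h; apply/eqP; rewrite subr_eq addrAC eq_sym subr_eq addrC -h. Qed.

Lemma sumrBB (V : zmodType) (I : finType) (a b c : I -> V) :
  \sum_i (a i - b i - c i) = \sum_i a i - \sum_i b i - \sum_i c i.
Proof. by rewrite !sumrB. Qed.

Lemma vfield_comb (V : zmodType) (a b : V) : a - b - 0 + (0 - 0) = a - b.
Proof. by rewrite !subr0 addr0. Qed.

Lemma oneform_comb (V : zmodType) (a b c d : V) :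
  - c - - a - - b - - d = a + b - (c - d).
Proof. by rewrite !opprK opprB -!addrA [LHS]addrC -!addrA. Qed.

Lemma row_comb (V : zmodType) n (a b c d : 'rV[V]_n) k :
  (0 - a - b + (c - d)) 0 k = c 0 k - a 0 k - b 0 k - d 0 k.
Proof. by rewrite !mxE sub0r !addrA; congr (_ - _); rewrite addrC addrA. Qed.

Lemma rowB (V : zmodType) n (a b : 'rV[V]_n) k : (a - b) 0 k = a 0 k - b 0 k.
Proof. by rewrite !mxE. Qed.

Lemma ucm_inj (I : choiceType) : injective (@ucm I).
Proof.
move=> g g' /(congr1 (fun m : cmonom I => m g)); rewrite !ucmE eqxx.
by case: eqP.
Qed.

Lemma divcmm (I : choiceType) (m : cmonom I) : divcm m m = onecm I.
Proof. by apply/eqP/cmP => i; rewrite divcmE onecmE subnn. Qed.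

Lemma mulcmI (I : choiceType) (m : cmonom I) : injective (fun m' => mulcm m' m).
Proof.
move=> m1 m2 m12; apply/eqP/cmP => g; apply: (@addIn (m g)).
by rewrite -!mulcmE m12.
Qed.

Lemma mulcmK (I : choiceType) (m m' : cmonom I) : divcm (mulcm m m') m = m'.
Proof. by apply/eqP/cmP => g; rewrite divcmE mulcmE addKn. Qed.

Lemma oppr_add_opp (V : zmodType) (a b : V) : - (- a + b) = a - b.
Proof. by rewrite opprD opprK. Qed.

Lemma malgZU (R : nzRingType) (I : choiceType) (u w : R) (l : I) :
  u *: << w *g l >> = << u * w *g l >> :> {malg R[I]}.
Proof.
apply/malgP => k; rewrite mcoeffZ !mcoeffU.
by case: eqP => _; rewrite ?mulr1n // mulr0.
Qed.

Lemma msupp_empty (G : zmodType) (I : choiceType) (x : {malg G[I]}) :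
  (forall l, l \notin msupp x) -> x = 0.
Proof. by move=> xl; apply/malgP => l; rewrite mcoeff0 mcoeff_outdom. Qed.

(** * Evaluation of [lift] on sums of basis states *)

Section Lift.
Variables (D : nat) (K : fieldType).
Local Notation R := (fps D K).
Local Notation S := (state D K).
Implicit Types (f : label D -> R -> S) (x y : S) (l : label D) (u : R).

(** Labels outside the support carry coefficient 0, so they add nothing once [f l 0 = 0]. This
    allows sums over different supports to be compared over a common set. *)
Lemma lift_widen f x (d : {fset label D}) : (forall l, l \in d -> f l 0 = 0) ->
  (msupp x `<=` d)%fset -> lift f x = \sum_(l <- d) f l x@_l.
Proof.
move=> f0 xd; rewrite /lift; apply: big_fset_incl => // l ld lx.
by rewrite (mcoeff_outdom lx) f0.
Qed.

Lemma liftU f l u : f l 0 = 0 -> lift f << u *g l >> = f l u.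
Proof.
move=> f0; rewrite (lift_widen (d := [fset l]%fset) _ msuppU_le).
  by rewrite big_seq_fset1 mcoeffUU.
by move=> l'; rewrite in_fset1 => /eqP ->.
Qed.

Lemma lift0 f : lift f 0 = 0.
Proof. by rewrite /lift msupp0 big_seq_fset0. Qed.

Lemma liftD f : (forall l, {morph f l : u v / u + v}) ->
  {morph lift f : x y / x + y}.
Proof.
move=> fD x y.
pose d := (msupp x `|` msupp y)%fset.
have f0 l : l \in d -> f l 0 = 0.
  by move=> _; apply: (addrI (f l 0)); rewrite -fD !addr0.
rewrite (lift_widen (x := x + y) (d := d) f0 (msuppD_le _ _)).
rewrite (lift_widen (x := x) (d := d) f0 (fsubsetUl _ _)).
rewrite (lift_widen (x := y) (d := d) f0 (fsubsetUr _ _)).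
by rewrite -big_split /=; apply: eq_bigr => l _; rewrite mcoeffD fD.
Qed.

(* Unlike [liftD], this does not require [f l] to be additive. *)
Lemma lift_sumU f (I : finType) (L : I -> label D) (U : I -> R) :
  injective L -> (forall i, f (L i) 0 = 0) ->
  lift f (\sum_i << U i *g L i >>) = \sum_i f (L i) (U i).
Proof.
move=> Linj f0; set x := \sum_i _.
have xE l : x@_l = \sum_i U i *+ (L i == l).
  by rewrite raddf_sum /=; apply: eq_bigr => i _; rewrite mcoeffU.
have xL i : x@_(L i) = U i.
  rewrite xE (bigD1 i) //= eqxx big1 ?addr0 // => j ji.
  by rewrite (inj_eq Linj) (negbTE ji).
pose d := [fset L i | i in I]%fset.
have xd : (msupp x `<=` d)%fset.
  apply/fsubsetP => l; rewrite -mcoeff_neq0 xE; apply: contraR => ld.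
  rewrite big1 // => i _; case: eqP ld => // <-.
  by rewrite in_imfset.
rewrite (lift_widen _ xd); last by move=> _ /imfsetP[i _ ->]; apply: f0.
rewrite big_imfset /=; last by move=> i j _ _ /Linj.
rewrite big_enum /=; apply: eq_bigr => i _; by rewrite xL.
Qed.

Lemma msupp_lift f x l : l \in msupp (lift f x) ->
  exists2 l', l' \in msupp x & l \in msupp (f l' x@_l').
Proof.
rewrite -mcoeff_neq0 raddf_sum /= => n0.
have [/hasP[l' xl' fl']|/hasPn h] :=
  boolP (has (fun l' => (f l' x@_l')@_l != 0) (msupp x)).
  by exists l' => //; rewrite -mcoeff_neq0.
by rewrite big_seq big1 ?eqxx // in n0 => l' /h; rewrite negbK => /eqP.
Qed.

Lemma msuppUP l l' u : l' \in msupp (<< u *g l >> : S) -> l' = l /\ u != 0.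
Proof.
by rewrite msuppU; case: eqP => // _; rewrite in_fset1 => /eqP.
Qed.

End Lift.

(** * States of weight 0 and 1, and the action of the modes on them *)

Section Modes.
Variables (D : nat) (K : fieldType).
Local Notation R := (fps D K).
Local Notation S := (state D K).
Implicit Types (x y v : S) (l : label D) (u w : R) (e : int) (s : {fset ghost}).
Implicit Types (X : gsection D K) (i j : 'I_D).

Lemma fpsC1 : fpsC D (1 : K) = 1. Proof. by []. Qed.

Lemma fps_partial_nmod i : nmod_morphism (@fps_partial D K i).
Proof. by split=> [|u w]; apply: fpsP => m /=; rewrite ?mul0rn ?mulrnDl. Qed.

HB.instance Definition _ i :=
  GRing.isNmodMorphism.Build R R (@fps_partial D K i) (fps_partial_nmod i).

Lemma hmul_nmod e : nmod_morphism (@hmul D K e).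
Proof.
split=> [|x y]; first exact: lift0.
by rewrite /hmul liftD // => l u w; rewrite monalgUD.
Qed.

HB.instance Definition _ e :=
  GRing.isNmodMorphism.Build S S (@hmul D K e) (hmul_nmod e).

(** In [osc] the index 0 encodes mode -1, so these are p_{i,-1} and X^j_{-1}, the only creation
    operators that occur in weight 1. *)
Definition osc1 (g : 'I_D + 'I_D) : osc D :=
  match g with inl i => inl (i, 0) | inr j => inr (j, 0) end.

Definition component X (g : 'I_D + 'I_D) : R :=
  match g with inl i => X.1 0 i | inr j => X.2 0 j end.

Lemma osc1_inj : injective osc1.
Proof. by move=> [i|i] [j|j] //= [->]. Qed.

(* The states are locked, since unification would otherwise unfold them when it
   compares them with sums of states. *)
Fact state_key : unit. Proof. by []. Qed.

Definition state0 e s u : S :=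
  locked_with state_key << u *g ((e, onecm _, s) : label D) >>.

(** This is h^e times the section state with ghosts [s]. The matter modes leave [s] alone, so the
    same computations serve both V^1 ([s] empty) and c V^1. *)
Definition state1 e s X : S :=
  locked_with state_key
    (\sum_g << component X g *g ((e, ucm (osc1 g), s) : label D) >>).

Lemma state0E e s u : state0 e s u = << u *g ((e, onecm _, s) : label D) >>.
Proof. by rewrite /state0 locked_withE. Qed.

Lemma state1E e s X : state1 e s X =
  \sum_g << component X g *g ((e, ucm (osc1 g), s) : label D) >>.
Proof. by rewrite /state1 locked_withE. Qed.

Lemma component_additive g : {morph component^~ g : X Y / X + Y}.
Proof. by move: g => [i|j] X1 X2; rewrite /= mxE. Qed.

Lemma componentZ u X g : component (u *: X) g = u * component X g.
Proof. by case: g => i /=; rewrite mxE. Qed.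

Lemma state1_nmod e s : nmod_morphism (state1 e s).
Proof.
split=> [|X1 X2].
  by rewrite state1E big1 // => -[] i _; rewrite /= mxE monalgU0.
rewrite !state1E -big_split; apply: eq_bigr => g _ /=.
by rewrite component_additive monalgUD.
Qed.

HB.instance Definition _ e s :=
  GRing.isNmodMorphism.Build (gsection D K) S (state1 e s) (state1_nmod e s).

Lemma state1Z e s u X : u *: state1 e s X = state1 e s (u *: X).
Proof.
rewrite !state1E scaler_sumr; apply: eq_bigr => g _.
by rewrite malgZU componentZ.
Qed.

Lemma state0Z e s u w : u *: state0 e s w = state0 e s (u * w).
Proof. by rewrite !state0E malgZU. Qed.

Lemma state0_nmod e s : nmod_morphism (state0 e s).
Proof. by split=> [|u w]; rewrite !state0E ?monalgU0 ?monalgUD. Qed.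

HB.instance Definition _ e s :=
  GRing.isNmodMorphism.Build R S (state0 e s) (state0_nmod e s).

Lemma state0D e s : {morph state0 e s : u w / u + w}.
Proof. exact: raddfD. Qed.

Lemma state0N e s : {morph state0 e s : u / - u}.
Proof. exact: raddfN. Qed.

Lemma state1D e s : {morph state1 e s : X1 X2 / X1 + X2}.
Proof. exact: raddfD. Qed.

Lemma state1N e s : {morph state1 e s : X / - X}.
Proof. exact: raddfN. Qed.

Lemma msupp_state0 e s u l : l \in msupp (state0 e s u) -> l = (e, onecm _, s).
Proof. by rewrite state0E => /msuppUP[-> _]. Qed.

Lemma msupp_state1 e s X l : l \in msupp (state1 e s X) ->
  exists g, l = (e, ucm (osc1 g), s).
Proof.
rewrite state1E -mcoeff_neq0 raddf_sum /= => n0.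
apply: contra_notP (negP (negbT (introF eqP (elimN eqP n0)))) => h.
rewrite big1 // => g _; rewrite mcoeffU; case: eqP => // lE.
by case: h; exists g.
Qed.

Lemma lift_state0 f e s u : f (e, onecm _, s) 0 = 0 ->
  lift f (state0 e s u) = f (e, onecm _, s) u.
Proof. by rewrite state0E; apply: liftU. Qed.

Lemma lift_state1 f e s X : (forall g, f (e, ucm (osc1 g), s) 0 = 0) ->
  lift f (state1 e s X) = \sum_g f (e, ucm (osc1 g), s) (component X g).
Proof.
move=> f0; rewrite state1E lift_sumU // => g g' [] /ucm_inj.
exact: osc1_inj.
Qed.

Lemma hmul0 x : hmul 0 x = x.
Proof.
rewrite /hmul /lift [RHS]monalgE; apply: eq_bigr => -[[e m] s] _ /=.
by rewrite addr0.
Qed.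

Lemma hmul_state0 a e s u : hmul a (state0 e s u) = state0 (e + a) s u.
Proof. by rewrite /hmul lift_state0 ?state0E // monalgU0. Qed.

Lemma hmul_state1 a e s X : hmul a (state1 e s X) = state1 (e + a) s X.
Proof. by rewrite /hmul lift_state1 ?state1E // => l; rewrite monalgU0. Qed.

Lemma osc_deriv_state0 g e s u : osc_deriv g (state0 e s u) = 0.
Proof.
rewrite /osc_deriv lift_state0; last by rewrite mul0rn monalgU0.
by rewrite onecmE mulr0n monalgU0.
Qed.

Lemma osc_deriv_state1 g e s X :
  osc_deriv g (state1 e s X) =
    \sum_(g' | osc1 g' == g) state0 e s (component X g').
Proof.
rewrite /osc_deriv lift_state1 => [|l]; last by rewrite mul0rn monalgU0.
rewrite [RHS]big_mkcond; apply: eq_bigr => g' _ /=; rewrite ucmE.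
case: eqP => [<-|_]; first by rewrite divcmm state0E.
by rewrite mulr0n monalgU0.
Qed.

Lemma osc_deriv1_state1 g e s X :
  osc_deriv (osc1 g) (state1 e s X) = state0 e s (component X g).
Proof.
rewrite osc_deriv_state1 (big_pred1 g) // => g'.
by rewrite /= (inj_eq osc1_inj).
Qed.

Definition vfield1 i u : gsection D K := (u *: delta_mx 0 i, 0).
Definition oneform1 i u : gsection D K := (0, u *: delta_mx 0 i).

Lemma fst_sum (I : finType) (F : I -> gsection D K) :
  (\sum_i F i).1 = \sum_i (F i).1.
Proof. exact: (big_morph (fun X : gsection D K => X.1)). Qed.

Lemma snd_sum (I : finType) (F : I -> gsection D K) :
  (\sum_i F i).2 = \sum_i (F i).2.
Proof. exact: (big_morph (fun X : gsection D K => X.2)). Qed.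

Lemma sum_vfield1 (A : vfield D K) : \sum_i vfield1 i (A 0 i) = (A, 0).
Proof.
apply: injective_projections; rewrite ?fst_sum ?snd_sum /=.
  by rewrite [RHS]row_sum_delta.
by rewrite big1.
Qed.

Lemma sum_oneform1 (B : oneform D K) : \sum_i oneform1 i (B 0 i) = (0, B).
Proof.
apply: injective_projections; rewrite ?fst_sum ?snd_sum /=.
  by rewrite big1.
by rewrite [RHS]row_sum_delta.
Qed.

Lemma osc_mul_state0 g e s u :
  osc_mul (osc1 g) (state0 e s u) =
    state1 e s (match g with inl i => vfield1 i u | inr j => oneform1 j u end).
Proof.
rewrite /osc_mul lift_state0; last by rewrite monalgU0.
rewrite /= mul0cm state1E (bigD1 g) //= big1 ?addr0 => [|g' g'g].
  by case: g => i /=; rewrite !mxE !eqxx mulr1.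
case: g g' g'g => i [j|j] /= ji; rewrite !mxE ?monalgU0 //;
  by case: (eqVneq j i) ji => [->|_ _]; rewrite ?eqxx // andbF mulr0 monalgU0.
Qed.

Lemma Xmode1_state1 i e s X :
  Xmode i 1 (state1 e s X) = state0 (e + 1) s (X.1 0 i).
Proof. by rewrite /= (osc_deriv1_state1 (inl i)) hmul_state0. Qed.

Lemma Xmode_ge2_state1 i k e s X : Xmode i k.+2 (state1 e s X) = 0.
Proof. by rewrite /= osc_deriv_state1 big1 ?raddf0 // => -[] j /eqP. Qed.

Lemma XmodeN1_state0 i e s u :
  Xmode i (- 1) (state0 e s u) = state1 e s (oneform1 i u).
Proof. exact: (osc_mul_state0 (inr i)). Qed.

Lemma pmodeN1_state0 i e s u :
  pmode i (- 1) (state0 e s u) = state1 e s (vfield1 i u).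
Proof. exact: (osc_mul_state0 (inl i)). Qed.

Definition spartial i X : gsection D K :=
  (map_mx (fps_partial i) X.1, map_mx (fps_partial i) X.2).

(** The zero mode p_{i,0} is -h d/dX^i on power series and commutes with p_{j,-1} and X^j_{-1}; it
    therefore differentiates the components one by one. *)
Lemma pmode0_state1 i e s X :
  pmode i 0 (state1 e s X) = state1 (e + 1) s (- spartial i X).
Proof.
have zd : zero_deriv i (state1 e s X) = state1 e s (spartial i X).
  rewrite /zero_deriv lift_state1 => [|l]; last by rewrite raddf0 monalgU0.
  by rewrite state1E; apply: eq_bigr => -[] j _ /=; rewrite mxE.
by rewrite /pmode zd hmul_state1 [RHS]raddfN.
Qed.

(** The sign comes from [p_{i,1}, X^i_{-1}] = -h. *)
Lemma pmode1_state1 i e s X :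
  pmode i 1 (state1 e s X) = state0 (e + 1) s (- X.2 0 i).
Proof. by rewrite /= (osc_deriv1_state1 (inr i)) hmul_state0 raddfN. Qed.

Lemma pmode_ge2_state1 i k e s X : pmode i k.+2 (state1 e s X) = 0.
Proof. by rewrite /= osc_deriv_state1 big1 ?raddf0 ?oppr0 // => -[] j /eqP. Qed.

Lemma Xmode0 i n : Xmode i n (0 : S) = 0.
Proof.
by case: n => [[|k]|k] /=; rewrite ?scaler0 // /osc_deriv /osc_mul lift0 ?raddf0.
Qed.

Lemma pmode0 i n : pmode i n (0 : S) = 0.
Proof.
by case: n => [[|k]|k] /=;
  rewrite /osc_deriv /osc_mul /zero_deriv lift0 ?raddf0 ?oppr0.
Qed.

End Modes.

(** * Finiteness of the Taylor expansion of u(X(z)) *)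

Section FunField.
Variables (D : nat) (K : fieldType).
Local Notation R := (fps D K).
Local Notation S := (state D K).
Implicit Types (x y v : S) (l : label D) (u w : R) (e : int) (s : {fset ghost}).
Implicit Types (X : gsection D K) (i j : 'I_D) (m : {cmonom (osc D)}).
Implicit Types (t : 'I_D * int) (r : seq ('I_D * int)).

(** For n > 0, X^i_n is h times the derivation with respect to p_{i,-n}. Giving p_{i,-n} weight n
    and the X oscillators weight 0 makes X^i_n lower the weight by n, while the other X modes
    preserve it. *)
Definition osc_pweight (g : osc D) : nat :=
  if g is inl (_, k) then k.+1 else 0.

Definition pweight m : nat := \sum_(g <- finsupp m) m g * osc_pweight g.

Lemma pweight_widen m (d : {fset osc D}) : (finsupp m `<=` d)%fset ->
  pweight m = \sum_(g <- d) (m g * osc_pweight g)%N.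
Proof.
move=> md; apply: big_fset_incl => // g _ gm.
by rewrite fsfun_dflt.
Qed.

Lemma pweight1 : pweight (onecm _) = 0%N.
Proof. by rewrite /pweight big1 // => g _; rewrite onecmE. Qed.

Lemma pweightU g : pweight (ucm g) = osc_pweight g.
Proof.
rewrite (@pweight_widen _ [fset g]%fset); last first.
  apply/fsubsetP => g'; rewrite mem_finsupp ucmE in_fset1 (eq_sym g).
  by case: (g' == g).
by rewrite big_seq_fset1 ucmE eqxx mul1n.
Qed.

Lemma pweightM m g : pweight (mulcm m (ucm g)) = (pweight m + osc_pweight g)%N.
Proof.
pose d := (g |` finsupp m)%fset.
rewrite (@pweight_widen (mulcm m (ucm g)) d); last first.
  apply/fsubsetP => g'; rewrite mem_finsupp mulcmE ucmE in_fset1U (eq_sym g).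
  by case: (g' == g) => //=; rewrite addn0 mem_finsupp.
rewrite (@pweight_widen m d) ?fsubsetU1 // -pweightU.
rewrite (@pweight_widen (ucm g) d) -?big_split /=; last first.
  apply/fsubsetP => g'; rewrite mem_finsupp ucmE in_fset1U (eq_sym g).
  by case: (g' == g).
by apply: eq_bigr => g' _; rewrite mulcmE mulnDl.
Qed.

Lemma mulcm_divcm m g : m g != 0%N -> mulcm (divcm m (ucm g)) (ucm g) = m.
Proof.
move=> mg; apply/eqP/cmP => g'; rewrite mulcmE divcmE ucmE.
by case: (eqVneq g g') mg => [<- mg|_ _]; rewrite ?subn0 ?addn0 // subnK ?lt0n.
Qed.

(* [a] is the sum of the positive indices of the modes X_n applied so far. *)
Definition pweight_le (N a : nat) v :=
  forall l, l \in msupp v -> (pweight l.1.2 + a <= N)%N.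

Lemma pweight_le_state0 e s u : pweight_le 0 0 (state0 e s u).
Proof. by move=> l /msupp_state0 ->; rewrite pweight1. Qed.

Lemma pweight_le_state1 e s X : pweight_le 1 0 (state1 e s X).
Proof. by move=> l /msupp_state1[g ->]; rewrite pweightU; case: g. Qed.

Definition ppart (n : int) : nat := if n is Posz k then k else 0.

Lemma pweight_le_Xmode N a i n v :
  pweight_le N a v -> pweight_le N (a + ppart n) (Xmode i n v).
Proof.
move=> va l; case: n => [[|k]|k]; rewrite /Xmode /ppart.
- by rewrite addn0 => lv; apply: va; apply: (fsubsetP (msuppZ_le _ _)) lv.
- case/msupp_lift => l1 + /msuppUP[-> _] /=.
  case/msupp_lift => l2 l2v /msuppUP[-> /=].
  (* If p_{i,-k-1} is absent from the monomial, the coefficient is multiplied by 0; otherwise the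
     truncated [divcm] is a genuine division. *)
  have [->|m0 _] := eqVneq (l2.1.2 (inl (i, k))) 0%N; first by rewrite mulr0n eqxx.
  have := congr1 pweight (mulcm_divcm m0); rewrite pweightM /osc_pweight.
  by have := va _ l2v => /[swap] <-; rewrite -addnA (addnC k.+1).
case/msupp_lift => l2 l2v /msuppUP[-> _ /=]; rewrite pweightM /=.
by have := va _ l2v; lia.
Qed.

Definition Xmodes r v := foldr (fun t => Xmode t.1 t.2) v r.

(** Positive modes of total index above N would lower a weight that is at most N below zero, so no
    label can survive. *)
Lemma Xmodes_eq0 N r v : pweight_le N 0 v ->
  (N < \sum_(t <- r) ppart t.2)%N -> Xmodes r v = 0.
Proof.
move=> v0.
have : pweight_le N (\sum_(t <- r) ppart t.2) (Xmodes r v).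
  elim: r => [|t r IH] /=; first by rewrite big_nil.
  by rewrite big_cons addnC; apply: pweight_le_Xmode.
move=> le_r lt_r; apply: msupp_empty => l; apply/negP => /le_r.
by rewrite leqNgt (leq_trans lt_r) // leq_addl.
Qed.

(** Each nonzero index n satisfies n + 1 <= 2 max(n, 0). Summing bounds the length of a sequence by
    its total index and its positive part. *)
Lemma sum_size_le r : all (fun t => t.2 != 0) r ->
  \sum_(t <- r) t.2 + (size r)%:Z <= (2 * \sum_(t <- r) ppart t.2)%N%:Z.
Proof.
elim: r => [|[i n] r IH] /=; first by rewrite !big_nil.
case/andP => /= n0 /IH; rewrite !big_cons /=.
set a := \sum_(t <- r) t.2; set b := (\sum_(t <- r) ppart t.2)%N.
case: n n0 => [k|k] /= k0; rewrite ?NegzE; lia.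
Qed.

Definition fun_term u r v : S :=
  (fpsC D ((size r)`!%:R^-1 : K) * foldr (fun t => fps_partial t.1) u r)
      *: Xmodes r v.

Local Open Scope classical_set_scope.

(** The infinite Taylor sum reduces to any finite list of admissible sequences that contains those
    with positive part at most N; [sum_size_le] turns this into the length bound 2N - n - 1, which
    the applications use to enumerate the sequences. *)
Lemma fun_field_seq N u n v (rs : seq (seq ('I_D * int))) :
  pweight_le N 0 v -> uniq rs ->
  (forall r, r \in rs -> all (fun t => t.2 != 0) r /\ \sum_(t <- r) t.2 = n + 1) ->
  (forall r, all (fun t => t.2 != 0) r -> \sum_(t <- r) t.2 = n + 1 ->
    (\sum_(t <- r) ppart t.2 <= N)%N ->
    ((size r)%:Z <= (2 * N)%N%:Z - n - 1)%R -> r \in rs) ->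
  fun_field u n v = \sum_(r <- rs) fun_term u r v.
Proof.
move=> vN urs rsP inrs; rewrite /fun_field (fsbigE rs) //; first last.
- move=> r [r0 rn] rrs; rewrite -/(Xmodes r v) (@Xmodes_eq0 N) ?scaler0 //.
  rewrite ltnNge; apply: contra rrs => rN; apply: inrs => //.
  have := sum_size_le r0; rewrite rn; lia.
rewrite big_mkcond big_seq [RHS]big_seq; apply: eq_bigr => r rrs.
by rewrite ifT // inE; apply: rsP.
Qed.

Lemma fun_field0 u n : fun_field u n (0 : S) = 0.
Proof.
apply: fsbig1 => r _.
suff -> : foldr (fun t => Xmode t.1 t.2) (0 : S) r = 0 by rewrite scaler0.
by elim: r => //= t r ->; rewrite Xmode0.
Qed.

Lemma fun_term_nil u v : fun_term u [::] v = u *: v.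
Proof. by rewrite /fun_term /= invr1 fpsC1 mul1r. Qed.

Lemma fun_term1 u t v : fun_term u [:: t] v = fps_partial t.1 u *: Xmode t.1 t.2 v.
Proof. by rewrite /fun_term /= invr1 fpsC1 mul1r. Qed.

(** Here N = 0 and n = -1, so the length bound is 0 and only the empty sequence remains. *)
Lemma fun_fieldN1_state0 u e s w :
  fun_field u (- 1) (state0 e s w) = state0 e s (u * w).
Proof.
rewrite (@fun_field_seq 0 _ _ _ [:: [::]]) //.
- by rewrite big_seq1 fun_term_nil state0Z.
- exact: pweight_le_state0.
- by move=> r; rewrite inE => /eqP ->; rewrite big_nil.
by case=> // t r _ _ _ /=; lia.
Qed.

Definition grad u : oneform D K := \row_i fps_partial i u.

(** The length bound is 1 and the total index is -1: the sequences are the single modes X^i_{-1},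
    whose Taylor coefficients are the components of du. *)
Lemma fun_fieldN2_state0 u e s w :
  fun_field u (- 2) (state0 e s w) = state1 e s (0, w *: grad u).
Proof.
rewrite (@fun_field_seq 0 _ _ _ [seq [:: (i, - 1)] | i <- enum 'I_D]).
- rewrite big_map big_enum -(sum_oneform1 (w *: grad u)) raddf_sum.
  apply: eq_bigr => i _; rewrite fun_term1 XmodeN1_state0 state1Z.
  by rewrite !mxE /oneform1 mulrC -scalerA; congr (state1 _ _ (_, _)); rewrite scaler0.
- exact: pweight_le_state0.
- by rewrite map_inj_uniq ?enum_uniq // => i j [].
- by move=> r /mapP[i _ ->]; rewrite big_seq1.
case=> [|[i n] [|t r]] //=; rewrite ?big_nil ?big_seq1 //=.
  by move=> _ -> _ _; rewrite map_f ?mem_enum.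
Qed.

End FunField.

(** * Zeroth and first products with a weight 1 state *)

Section Fields.
Variables (D : nat) (K : fieldType).
Local Notation R := (fps D K).
Local Notation S := (state D K).
Implicit Types (x y v : S) (l : label D) (u w : R) (e : int) (s : {fset ghost}).
Implicit Types (X : gsection D K) (i j : 'I_D) (n : int).

(** With N = 1 the length bound is 1 - n <= 0, but the empty sequence has total index 0 instead of n
    + 1. *)
Lemma fun_field_gt0_state1 u n e s X : (0 < n)%R ->
  fun_field u n (state1 e s X) = 0.
Proof.
move=> n0; rewrite (@fun_field_seq _ _ 1 _ _ _ [::]) ?big_nil //.
  exact: pweight_le_state1.
by case=> [|t r] _ /=; rewrite ?big_nil; lia.
Qed.

Definition vderiv X u : R := \sum_i X.1 0 i * fps_partial i u.

(** The bound is again 1 and the total index is 1. Each X^i_1 contracts with p_{i,-1}, which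
    produces the derivative of u along the vector field. *)
Lemma fun_field0_state1 u e s X :
  fun_field u 0 (state1 e s X) = state0 (e + 1) s (vderiv X u).
Proof.
rewrite (@fun_field_seq _ _ 1 _ _ _ [seq [:: (i, 1)] | i <- enum 'I_D]).
- rewrite big_map big_enum raddf_sum; apply: eq_bigr => i _.
  by rewrite fun_term1 Xmode1_state1 state0Z mulrC.
- exact: pweight_le_state1.
- by rewrite map_inj_uniq ?enum_uniq // => i j [].
- by move=> r /mapP[i _ ->]; rewrite big_seq1.
case=> [|[i n] [|t r]] //=; rewrite ?big_nil ?big_seq1 //=.
by move=> _ -> _ _; rewrite map_f ?mem_enum.
Qed.

(** The intermediate state has two oscillators and is no [state1]; X^i_1 then removes a p_{i,-1} and
    leaves X^j_{-1}. *)
Lemma Xmode1_XmodeN1_state1 i j e s X :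
  Xmode i 1 (Xmode j (- 1) (state1 e s X)) =
    state1 (e + 1) s (oneform1 j (X.1 0 i)).
Proof.
rewrite /= /osc_mul lift_state1 => [|g]; last by rewrite monalgU0.
rewrite /osc_deriv lift_sumU; first last.
- by move=> g; rewrite mul0rn monalgU0.
- by move=> g g' [] /mulcmI /ucm_inj; apply: osc1_inj.
rewrite (bigD1 (inl i)) //= big1 ?addr0 => [|g gi]; last first.
  have -> : mulcm (ucm (osc1 g)) (ucm (osc1 (inr j))) (osc1 (inl i)) = 0%N.
    by rewrite mulcmE !ucmE (inj_eq (@osc1_inj D)) (negbTE gi).
  by rewrite mulr0n monalgU0.
have -> : mulcm (ucm (osc1 (inl i))) (ucm (osc1 (inr j))) (osc1 (inl i)) = 1%N.
  by rewrite mulcmE !ucmE eqxx.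
rewrite mulr1n mulcmK.
by rewrite -XmodeN1_state0 /= /osc_mul lift_state0 ?monalgU0 // mul0cm /hmul liftU ?monalgU0.
Qed.

Lemma gradN w u : (0, - w *: grad u) = - (0, w *: grad u) :> gsection D K.
Proof. by congr (_, _); rewrite ?oppr0 // scaleNr. Qed.

(** Length at most 2 and total index 0 leave the empty sequence and the pairs with indices 1 and -1
    in either order. A pair trades some p_{i,-1} for some X^j_{-1} at the cost of one h, so it
    yields a 1-form of higher order. Only this shape matters at leading order, whence the
    existential. *)
Lemma fun_fieldN1_state1 u e s X : exists B : oneform D K,
  fun_field u (- 1) (state1 e s X) =
    state1 e s (u *: X) + state1 (e + 1) s (0, B).
Proof.
pose f (b : bool) (p : 'I_D * 'I_D) : seq ('I_D * int) :=
  if b then [:: (p.1, 1); (p.2, -1)] else [:: (p.1, -1); (p.2, 1)].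
(* [undup] supplies the uniqueness that [fun_field_seq] requires. *)
pose rs := undup [seq f b p | b <- enum {: bool}, p <- enum {: 'I_D * 'I_D}].
have rsP r : r \in rs -> exists b p, r = f b p.
  by rewrite mem_undup => /allpairsP[[b p] [_ _ ->]]; exists b, p.
have inrs b p : f b p \in rs.
  by rewrite mem_undup; apply/allpairsP; exists (b, p); rewrite !mem_enum.
rewrite (@fun_field_seq _ _ 1 _ _ _ ([::] :: rs)); first last.
- case=> [|[i n] [|[j k] [|? r]]] //=; rewrite ?big_cons ?big_nil /=.
    by move=> /andP[n0 _]; rewrite addr0 => ns; lia.
  rewrite addr0 !andbT addn0 => /andP[n0 k0] nk nk1 _.
  have [[-> ->]|[-> ->]] : n = 1 /\ k = -1 \/ n = -1 /\ k = 1.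
    by move: n k n0 k0 nk nk1 => [n|n] [k|k] /=; lia.
    by rewrite in_cons (inrs true (i, j)) orbT.
  by rewrite in_cons (inrs false (i, j)) orbT.
- move=> r; rewrite in_cons => /orP[/eqP ->|/rsP[[] [p ->]]];
    by rewrite ?big_cons ?big_nil.
- rewrite /= undup_uniq andbT; apply/negP => /rsP[[] [p]] //.
- exact: pweight_le_state1.
rewrite big_cons fun_term_nil state1Z.
suff [B ->] : exists B : oneform D K,
    \sum_(r <- rs) fun_term u r (state1 e s X) = state1 (e + 1) s (0, B).
  by exists B.
(* From here on only the shape of the members of [rs] is kept, so that the induction runs over an
   arbitrary list of such pairs. *)
clear inrs; clearbody rs; elim: rs rsP => [|r rs' IH] rsP.
  by exists 0; rewrite big_nil raddf0.
have [|B BE] := IH; first by move=> r' r'rs; apply: rsP; rewrite in_cons r'rs orbT.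
have [b [p rE]] := rsP r (mem_head _ _).
have [B' B'E] : exists B' : oneform D K,
    fun_term u r (state1 e s X) = state1 (e + 1) s (0, B').
  have [i [w rX]] : exists i w,
      Xmodes r (state1 e s X) = state1 (e + 1) s (oneform1 i w).
    rewrite rE; case: b {rE}.
      by exists p.2, (X.1 0 p.1); apply: Xmode1_XmodeN1_state1.
    exists p.1, (X.1 0 p.2); rewrite -XmodeN1_state0.
    apply: (congr1 (Xmode p.1 (- 1))).
    exact: Xmode1_state1.
  rewrite /fun_term rX state1Z; eexists; congr (state1 _ _ (_, _)).
  exact: scaler0.
exists (B' + B); rewrite big_cons BE B'E -state1D; congr state1.
by congr (_, _); rewrite addr0.
Qed.

(** On weight 1 states the modes of index at least 2 vanish, so only the summands for j = 0 and j =
    1 survive. *)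
Lemma normal_prod2 (a b : field D K) n v :
    (forall k, a (- 1 - k.+2%:Z) (b (n + k.+2%:Z) v) = 0) ->
    (forall k, b (n - 1 - k.+2%:Z) (a k.+2%:Z v) = 0) ->
  normal_prod false a b n v =
    a (- 1) (b n v) + b (n - 1) (a 0 v) + (a (- 2) (b (n + 1) v) + b (n - 2) (a 1 v)).
Proof.
move=> ab ba; rewrite /normal_prod (fsbigE (iota 0 2)) ?iota_uniq //; last first.
  move=> [|[|k]] _; rewrite ?mem_iota //= => _.
  by rewrite ab ba scaler0 addr0.
have inT k : (k \in [set: nat]%classic) = true by apply: mem_set.
rewrite !big_cons big_nil !inT expr0 !scale1r !addr0.
have -> : n - 1 - 1%:Z = n - 2 by rewrite -addrA.
by rewrite /= addr0.
Qed.

Lemma dXE i n v : dfield (Xfield i) n v = Xmode i n v *~ - n.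
Proof. by rewrite /dfield /Xfield subrK. Qed.

(** Three terms remain: p_{i,-1} after the derivative of u along X, u_{-1} after p_{i,0}, and u_{-2}
    after p_{i,1}. The second one carries the correction of [fun_fieldN1_state1]. *)
Lemma pfun_field0 i u e s X : exists B : oneform D K,
  normal_prod false (pfield i) (fun_field u) 0 (state1 e s X) =
    state1 (e + 1) s (vfield1 i (vderiv X u) - u *: spartial i X
                      - (0, X.2 0 i *: grad u))
    + state1 (e + 2) s (0, B).
Proof.
rewrite normal_prod2; first last.
- by move=> k; rewrite /pfield pmode_ge2_state1 fun_field0.
- by move=> k; rewrite fun_field_gt0_state1 // /pfield pmode0.
rewrite /pfield fun_field0_state1 pmodeN1_state0 fun_field_gt0_state1 // pmode0.
rewrite pmode0_state1 pmode1_state1 add0r fun_fieldN2_state0.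
have [B ->] := fun_fieldN1_state1 u (e + 1) s (- spartial i X).
exists B; have -> : e + 1 + 1 = e + 2 by rewrite -addrA.
move: (e + 1) (e + 2) => e1 e2.
rewrite [state1 e1 s (_ + _ + _)]state1D [state1 e1 s (_ + _)]state1D.
by rewrite scalerN gradN add0r addrA [LHS]addrAC.
Qed.

(** The leading term is the single contraction of p_i with dX^i. The term with one more h is the
    double contraction, where p_{i,0} differentiates X and the result differentiates u. *)
Lemma pfun_field1 i u e s X :
  normal_prod false (pfield i) (fun_field u) 1 (state1 e s X) =
    state0 (e + 1) s (- (u * X.2 0 i))
    + state0 (e + 2) s (vderiv (- spartial i X) u).
Proof.
rewrite normal_prod2; first last.
- by move=> k; rewrite /pfield pmode_ge2_state1 fun_field0.
- by move=> k; rewrite fun_field_gt0_state1 // /pfield pmode0.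
rewrite /pfield pmode0_state1 pmode1_state1 (@fun_field_gt0_state1 _ 1) //
  (@fun_field_gt0_state1 _ (1 + 1)) //.
rewrite !pmode0.
rewrite fun_field0_state1. rewrite fun_fieldN1_state0.
rewrite add0r_pair.
by have -> : e + 1 + 1 = e + 2 by [rewrite -addrA]; rewrite [LHS]addrC mulrN.
Qed.

(** Mode n of dX^j is -n X^j_n. Its zero mode thus vanishes, which is why there is no correction of
    higher order here. *)
Lemma xfun_field0 j u e s X :
  normal_prod false (dfield (Xfield j)) (fun_field u) 0 (state1 e s X) =
    state1 (e + 1) s (oneform1 j (vderiv X u) - (0, X.1 0 j *: grad u)).
Proof.
rewrite normal_prod2; first last.
- by move=> k; rewrite dXE Xmode_ge2_state1 mul0rz fun_field0.
- by move=> k; rewrite dXE fun_field_gt0_state1 // Xmode0 mul0rz.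
rewrite !dXE Xmode1_state1 fun_field0_state1 XmodeN1_state0.
rewrite (@fun_field_gt0_state1 _ (0 + 1)) //.
rewrite (Xmode0 _ _ (- 2)) mul0rz mulr1z oppr0 mulr0z fun_field0.
rewrite mulrN1z -state0N fun_fieldN2_state0 gradN.
by rewrite [RHS]state1D [X in X + _ = _]addr0 [X in _ + X = _]add0r.
Qed.

Lemma xfun_field1 j u e s X :
  normal_prod false (dfield (Xfield j)) (fun_field u) 1 (state1 e s X) =
    state0 (e + 1) s (- (u * X.1 0 j)).
Proof.
rewrite normal_prod2; first last.
- by move=> k; rewrite dXE Xmode_ge2_state1 mul0rz fun_field0.
- by move=> k; rewrite dXE fun_field_gt0_state1 // Xmode0 mul0rz.
rewrite !dXE Xmode1_state1 (@fun_field_gt0_state1 _ 1) //.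
rewrite (@fun_field_gt0_state1 _ (1 + 1)) // (Xmode0 _ _ (- 1)) (Xmode0 _ _ (- 2)).
rewrite !mul0rz oppr0 mulr0z fun_field0 mulrN1z -state0N fun_fieldN1_state0.
by rewrite [X in X + _ = _]addr0 [LHS]add0r [LHS]add0r mulrN.
Qed.

Lemma ddfield0 (a : field D K) : ddfield 0 a = a.
Proof. by apply/funext => n; apply/funext => v; rewrite /ddfield /= invr1 fpsC1 scale1r. Qed.

Lemma ddfield1 (a : field D K) : ddfield 1 a = dfield a.
Proof. by apply/funext => n; apply/funext => v; rewrite /ddfield /= invr1 fpsC1 scale1r. Qed.

Lemma fun_field_zero n v : fun_field (0 : R) n v = 0.
Proof.
apply: fsbig1 => r _.
suff -> : foldr (fun t : 'I_D * int => fps_partial t.1) (0 : R) r = 0.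
  by rewrite mulr0 scale0r.
by elim: r => //= t r ->; rewrite raddf0.
Qed.

(** It gives the vanishing at coefficient 0 that is needed to evaluate [Y] on a sum of basis
    states. *)
Lemma normal_prod_zero odd (a : field D K) n v : (forall n, a n 0 = 0) ->
  normal_prod odd a (fun_field 0) n v = 0.
Proof.
move=> a0; apply: fsbig1 => k _.
by rewrite !fun_field_zero a0 scaler0 addr0.
Qed.

Lemma term_field_fun e u : term_field (e, onecm _, fset0) u = fun_field u.
Proof.
rewrite /term_field /= /matter_field.
have -> : finsupp (onecm (osc D)) = fset0.
  by apply/fsetP => g; rewrite mem_finsupp onecmE in_fset0.
by [].
Qed.

Lemma term_field1 e g u :
  term_field (e, ucm (osc1 g), fset0) u =
    normal_prod false (match g with inl i => pfield i | inr j => dfield (Xfield j) end)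
      (fun_field u).
Proof.
rewrite /term_field /= /matter_field.
have -> : finsupp (ucm (osc1 g)) = [fset osc1 g]%fset.
  apply/fsetP => g'; rewrite mem_finsupp ucmE in_fset1 (eq_sym (osc1 g)).
  by case: (g' == osc1 g).
have -> : enum_fset [fset osc1 g]%fset = [:: osc1 g].
  by apply: perm_small_eq => //; apply: uniq_perm => // g';
    rewrite !inE.
rewrite /= ucmE eqxx /=.
by case: g => i /=; rewrite ?ddfield0 ?ddfield1.
Qed.

Lemma Y_state1 n v X :
  Y (state1 0 fset0 X) n v =
    \sum_i normal_prod false (pfield i) (fun_field (X.1 0 i)) n v
    + \sum_j normal_prod false (dfield (Xfield j)) (fun_field (X.2 0 j)) n v.
Proof.
rewrite /Y lift_state1 => [|g].
  by rewrite big_sumType; congr (_ + _); apply: eq_bigr => i _;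
    rewrite term_field1 hmul0.
rewrite term_field1 hmul0 normal_prod_zero //.
by case: g => [i|j] m; rewrite ?dXE /pfield ?pmode0 ?Xmode0 ?mul0rz.
Qed.

Lemma Y_state0 n v u : Y (state0 0 fset0 u) n v = fun_field u n v.
Proof.
rewrite /Y lift_state0 term_field_fun hmul0 //.
exact: fun_field_zero.
Qed.

End Fields.

(** * Uniqueness of leading coefficients in powers of h *)

Section Grading.
Variables (D : nat) (K : fieldType).
Local Notation R := (fps D K).
Local Notation S := (state D K).
Implicit Types (x y v r : S) (l : label D) (u w : R) (e : int) (s : {fset ghost}).
Implicit Types (X : gsection D K) (i j : 'I_D) (n : int) (Q : int -> Prop).

Lemma hmulU e l u :
  hmul e (<< u *g l >> : S) = << u *g ((l.1.1 + e, l.1.2, l.2) : label D) >>.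
Proof. by rewrite /hmul liftU // monalgU0. Qed.

Lemma hmulD e : {morph @hmul D K e : x y / x + y}.
Proof. exact: raddfD. Qed.

Lemma hmulN e : {morph @hmul D K e : x / - x}.
Proof. exact: raddfN. Qed.

Lemma hmul_hmul a b x : hmul a (hmul b x) = hmul (b + a) x.
Proof.
rewrite {2}/hmul /lift raddf_sum [RHS]/hmul /lift; apply: eq_bigr => l _.
by rewrite /= hmulU /= addrA.
Qed.

(* [inr 0] is c_1. This degree vanishes on F and is nonnegative on F[h]. *)
Definition hdegree l : int := l.1.1 - (#|` (l.2 `\ inr 0%N)%fset|)%:Z.

(** A general predicate [Q] lets multiplication by h or by a ghost act by a shift inside the
    predicate. *)
Definition hsupp Q x := forall l, l \in msupp x -> Q (hdegree l).

Lemma hsupp0 Q : hsupp Q 0.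
Proof. by move=> l; rewrite msupp0. Qed.

Lemma hsuppD Q x y : hsupp Q x -> hsupp Q y -> hsupp Q (x + y).
Proof.
move=> Qx Qy l /(fsubsetP (msuppD_le _ _)); rewrite in_fsetU.
by case/orP => [/Qx|/Qy].
Qed.

Lemma hsupp_hmul Q e x :
  hsupp (fun d => Q (d + e)) x -> hsupp Q (hmul e x).
Proof.
move=> Qx _ /msupp_lift[l lx /msuppUP[-> _]].
by have := Qx _ lx; rewrite /hdegree /= addrAC.
Qed.

Lemma hsupp_c1 Q x : hsupp Q x -> hsupp Q (cmode 1 x).
Proof.
move=> Qx l /msupp_lift[l' l'x]; case: ifP => [_|l'0]; first by rewrite msupp0.
move=> /msuppUP[-> _]; have := Qx _ l'x; rewrite /hdegree /= fsetU1K //.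
  by rewrite mem_fsetD1 // l'0.
by rewrite l'0.
Qed.

Lemma hsupp_ghost_mul Q k x :
  hsupp (fun d => Q (d - 1)) x -> hsupp Q (ghost_mul (inr k.+1) x).
Proof.
move=> Qx l /msupp_lift[l' l'x]; case: ifP => [_|l'0]; first by rewrite msupp0.
move=> /msuppUP[-> _]; have := Qx _ l'x; rewrite /hdegree /=.
have -> : ((inr k.+1 |` l'.2) `\ inr 0%N = inr k.+1 |` (l'.2 `\ inr 0%N))%fset.
  by apply/fsetP => g; rewrite !inE; case: eqP => [->|].
rewrite cardfsU1 !inE l'0 /= add1n intS.
by rewrite opprD addrA addrAC.
Qed.

Lemma hsupp_inV Q x : Q 0 -> inV x -> hsupp Q x.
Proof.
move=> Q0 xV l /xV[l0 ls].
by rewrite /hdegree l0 ls fset0D cardfs0 subr0.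
Qed.

(** In each of F_0, ..., F_3 every factor h is matched by one ghost other than c_1, and the two
    shifts cancel. *)
Lemma hsupp_F Q x : Q 0 -> F x -> hsupp Q x.
Proof.
move=> Q0 [x0 [x1 [x2 [x3 [[x0V _] [v1 [w1 [[v1V _] [w1V _] ->]]]
  [v2 [w2 [[v2V _] [w2V _] ->]]] [w3 [w3V _] ->] ->]]]]].
repeat apply: hsuppD.
- exact: hsupp_inV.
- by apply: hsupp_c1; apply: hsupp_inV.
- by apply: hsupp_hmul; apply: hsupp_ghost_mul; apply: hsupp_inV.
- apply: hsupp_hmul; apply: hsupp_c1; apply: hsupp_ghost_mul; exact: hsupp_inV.
- by apply: hsupp_hmul; apply: hsupp_c1; rewrite mulr2n; apply: hsuppD;
    apply: hsupp_ghost_mul; apply: hsupp_inV.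
by apply: hsupp_hmul; apply: hsupp_c1; apply: hsupp_ghost_mul; rewrite mulr2n;
  apply: hsuppD; apply: hsupp_ghost_mul; apply: hsupp_inV.
Qed.

Lemma hsupp_Fh x : Fh x -> hsupp (fun d => (0 <= d)%R) x.
Proof.
case=> t tF ->; elim/big_ind: _ => [|y z|k _]; first exact: hsupp0.
  exact: hsuppD.
apply: hsupp_hmul; apply: hsupp_F; last by apply/tF/mem_nth.
by rewrite /= add0r.
Qed.

(** Division by h^k gives r + h y = r' + h y'. Hence r - r' has degree 0 as a difference of elements
    of F, and degree at least 1 as h times an element of F[h]; its support is empty. *)
Lemma leading_uniq k x r r' : leading k x r -> leading k x r' -> r = r'.
Proof.
case=> rF [y yFh xE] [r'F [y' y'Fh xE']].
(* This is the division by h^k, possible because negative powers of h are allowed. *)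
have eqr (z w : S) : hmul (- k%:Z) (hmul k z + hmul k.+1 w) = z + hmul 1 w.
  have zE : hmul (- k%:Z) (hmul k z) = z by rewrite hmul_hmul (subrr k%:Z) hmul0.
  have wE : hmul (- k%:Z) (hmul k.+1 w) = hmul 1 w.
    by rewrite hmul_hmul; congr (hmul _ w); lia.
  exact: etrans (hmulD _ _ _) (f_equal2 _ zE wE).
have rE : r - r' = hmul 1 y' + hmul 1 (- y).
  rewrite hmulN; apply: subr_swap.
  have xx' := congr1 (hmul (- k%:Z)) (etrans (esym xE) xE').
  exact: etrans (esym (eqr r y)) (etrans xx' (eqr r' y')).
apply/eqP; rewrite -subr_eq0; apply/eqP/msupp_empty => l; apply/negP => lr.
have d0 : hdegree l = 0.
  move: (lr) => /(fsubsetP (msuppD_le _ _)).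
  rewrite in_fsetU msuppN => /orP[] lr'.
    exact: (hsupp_F (Q := fun d => d = 0) _ rF lr').
  exact: (hsupp_F (Q := fun d => d = 0) _ r'F lr').
suff : hsupp (fun d => (1 <= d)%R) (hmul 1 y' + hmul 1 (- y)).
  by rewrite -rE => /(_ _ lr); rewrite d0.
apply: hsuppD; apply: hsupp_hmul => l'.
  by move=> /(hsupp_Fh y'Fh); lia.
by rewrite msuppN => /(hsupp_Fh yFh); lia.
Qed.

Lemma xget_leading k x r : leading k x r -> xget 0 (leading k x) = r.
Proof.
by move=> lr; apply: (@leading_uniq k x) (lr); apply: xgetI lr.
Qed.

(** * Functions and sections as states of F *)

Lemma fun_stateE u : fun_state u = state0 0 fset0 u.
Proof. by rewrite /fun_state /vac state0E malgZU mulr1. Qed.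

Lemma gsectionE X : X = \sum_i vfield1 i (X.1 0 i) + \sum_j oneform1 j (X.2 0 j).
Proof.
by rewrite sum_vfield1 sum_oneform1; case: X => A B; congr (_, _);
  rewrite /= ?addr0 ?add0r.
Qed.

Lemma state1_sum e s X :
  \sum_i state1 e s (vfield1 i (X.1 0 i)) + \sum_j state1 e s (oneform1 j (X.2 0 j))
    = state1 e s X.
Proof. by rewrite [in RHS](gsectionE X) state1D !raddf_sum. Qed.

Lemma section_stateE X : section_state X = state1 0 fset0 X.
Proof.
rewrite -state1_sum; congr (_ + _); apply: eq_bigr => i _.
  by rewrite fun_stateE pmodeN1_state0.
by rewrite fun_stateE XmodeN1_state0.
Qed.

Definition c1 : {fset ghost} := [fset inr 0%N]%fset.

(** No ghost of [s] other than c_1 itself could stand before c_1, so the sign is trivial. *)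
Lemma ghost_sign_mul s u : (s `<=` c1)%fset ->
  ghost_sign D K (inr 0%N) s * u = u.
Proof.
move=> sc1; rewrite /ghost_sign.
suff -> : [fset g' in s | ghost_le g' (inr 0%N) && (g' != inr 0%N)]%fset = fset0.
  by rewrite cardfs0 expr0 mul1r.
apply/fsetP => g; rewrite !inE /=; apply/negP => /andP[/(fsubsetP sc1)].
by rewrite inE => /eqP ->; rewrite eqxx andbF.
Qed.

Lemma section_F1E X : section_F1 X = state1 0 c1 X.
Proof.
rewrite /section_F1 section_stateE /= /ghost_mul lift_state1 => [|g].
  rewrite state1E; apply: eq_bigr => g _ /=.
  by rewrite fsetU0 ghost_sign_mul ?fsub0set.
by rewrite mulr0 monalgU0; case: (_ \in _).
Qed.

Lemma ghost_parity_state1 e X : ghost_parity (state1 e c1 X) = state1 e c1 (- X).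
Proof.
rewrite state1N /ghost_parity lift_state1 => [|g].
  rewrite state1E -sumrN; apply: eq_bigr => g _ /=.
  by rewrite cardfs1 expr1 mulN1r monalgUN.
by rewrite mulr0 monalgU0.
Qed.

Lemma bmodeN1_state1 e X : bmode (- 1) (state1 e c1 X) = state1 e fset0 X.
Proof.
rewrite /= /ghost_deriv lift_state1 => [|g].
  rewrite state1E; apply: eq_bigr => g _ /=; rewrite fset11 fsetDv.
  by rewrite ghost_sign_mul.
by rewrite mulr0 monalgU0; case: (_ \in _).
Qed.

(** The terms p_{i,-1} X^i_1 and X^i_{-1} p_{i,1} recover the vector field and the 1-form, each with
    a factor -h that the prefactor -1/h of L(z) cancels. This places the state in V^1, hence c V^1
    in F_1. *)
Lemma L0_state1 e X : Lmode 0 (state1 e fset0 X) = state1 e fset0 X.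
Proof.
rewrite /Lmode /Lfield.
have LE i : normal_prod false (pfield i) (dfield (Xfield i)) 1 (state1 e fset0 X)
  = state1 (e + 1) fset0 (vfield1 i ((- X).1 0 i)) +
    state1 (e + 1) fset0 (oneform1 i ((- X).2 0 i)).
  rewrite normal_prod2; first last.
  - by move=> k; rewrite /pfield pmode_ge2_state1 dXE Xmode0 mul0rz.
  - by move=> k; rewrite /pfield dXE Xmode_ge2_state1 mul0rz pmode0.
  rewrite !dXE /pfield (pmode1_state1 i) (Xmode1_state1 i) (Xmode_ge2_state1 i 0).
  rewrite mul0rz (pmode0 _ _ (- 2)).
  have -> : - (1 - 1) = 0 :> int by [].
  have -> : - (1 - 2) = 1 :> int by [].
  rewrite [X in _ + X + _ = _]mulr0z [X in _ + (_ + X) = _]mulr1z.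
  rewrite mulrN1z -state0N pmodeN1_state0.
  rewrite [X in X + _ = _]addr0 [X in _ + X = _]add0r.
  rewrite (XmodeN1_state0 i _ _ _ : Xmode i (1 - 2) _ = _).
  by rewrite !mxE.
have -> : 0 + 1 = 1 :> int by [].
rewrite (_ : \sum_i _ = state1 (e + 1) fset0 (- X)).
  by rewrite hmul_state1 addrK state1N opprK.
by rewrite (eq_bigr _ (fun i _ => LE i)) big_split; apply: state1_sum.
Qed.

Lemma weight1_state1 X : weight 1 (state1 0 fset0 X).
Proof.
split; first by move=> l /msupp_state1[g ->].
by rewrite L0_state1 mulr1z.
Qed.

Lemma weight_0 n : weight n (0 : S).
Proof.
split; first by move=> l; rewrite msupp0.
by have := L0_state1 0 0; rewrite raddf0 mul0rz.
Qed.

(** Only the summand c V^1 of F_1 is nonzero; zero states fill the other components. *)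
Lemma F_state1 X : F (state1 0 c1 X).
Proof.
have g0 g : ghost_mul g (0 : S) = 0 by apply: lift0.
exists 0, (state1 0 c1 X), 0, 0; split.
- exact: weight_0.
- exists (state1 0 fset0 X), 0; split; [exact: weight1_state1|exact: weight_0|].
  by rewrite -section_stateE -/(section_F1 X) section_F1E /= g0 raddf0 addr0.
- exists 0, 0; split; [exact: weight_0|exact: weight_0|].
  by rewrite /= !g0 mul0rn !g0 !raddf0 addr0.
- by exists 0; [exact: weight_0 | rewrite /= !g0 mul0rn !g0 raddf0].
by rewrite add0r !addr0.
Qed.

Lemma Fh_state1 X : Fh (state1 0 c1 X).
Proof.
exists [:: state1 0 c1 X]; last by rewrite big_ord1 /= hmul0.
by move=> y; rewrite inE => /eqP ->; apply: F_state1.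
Qed.

Lemma leading_state1 k X X' :
  leading k (state1 k c1 X + state1 k.+1 c1 X') (state1 0 c1 X).
Proof.
split; first exact: F_state1.
exists (state1 0 c1 X'); first exact: Fh_state1.
by rewrite !hmul_state1 !add0r.
Qed.

Lemma mu_state1 u X : exists B : oneform D K,
  mu (fun_state u) (section_F1 X) =
    state1 0%N c1 (u *: X) + state1 1%N c1 (0, B).
Proof.
rewrite /mu fun_stateE section_F1E Y_state0.
exact: fun_fieldN1_state1.
Qed.

End Grading.

(** * Dorfman bracket, module structure and pairing *)

Section Main.
Variables (D : nat) (K : fieldType).
Local Notation R := (fps D K).
Local Notation S := (state D K).
Implicit Types (X : gsection D K) (i j : 'I_D).

Lemma sum_vfield1_row (f : 'I_D -> R) :
  \sum_i vfield1 i (f i) = (\row_i f i, 0) :> gsection D K.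
Proof. by rewrite -sum_vfield1; apply: eq_bigr => i _; rewrite mxE. Qed.

Lemma sum_oneform1_row (f : 'I_D -> R) :
  \sum_i oneform1 i (f i) = (0, \row_i f i) :> gsection D K.
Proof. by rewrite -sum_oneform1; apply: eq_bigr => i _; rewrite mxE. Qed.

(** The left side collects the leading terms of [pfun_field0] and [xfun_field0]. The sign in [- X1]
    is (-1)^|a_1|, since c V^1 is odd. *)
Lemma dorfmanE X1 X2 :
  \sum_i (vfield1 i (vderiv X2 ((- X1).1 0 i)) - (- X1).1 0 i *: spartial i X2
          - (0, X2.2 0 i *: grad ((- X1).1 0 i)))
  + \sum_j (oneform1 j (vderiv X2 ((- X1).2 0 j))
            - (0, X2.1 0 j *: grad ((- X1).2 0 j)))
  = dorfman X1 X2.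
Proof.
rewrite [X in X + _ = _]sumrBB [X in _ + X = _]sumrB.
rewrite sum_vfield1_row sum_oneform1_row.
apply: injective_projections; apply/rowP => k.
  rewrite /= !fst_sum /= !mxE !summxE.
  have Z : \sum_(i < D) (0 : 'rV[R]_D) 0 k = 0.
    by rewrite big1 // => i _; rewrite mxE.
  rewrite Z vfield_comb /vderiv -sumrB; apply: eq_bigr => i _.
  by rewrite !mxE raddfN mulrN mulNr opprK addrC.
rewrite /= !snd_sum /= row_comb rowB !summxE.
(* The first two sums assemble into the Lie derivative of B_2 along A_1, the last two into the
   contraction of dB_1 with A_2. *)
have s1 : \sum_(i < D) ((- X1.1) 0 i *: map_mx (fps_partial i) X2.2) 0 k =
    - \sum_(i < D) X1.1 0 i * fps_partial i (X2.2 0 k).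
  by rewrite -sumrN; apply: eq_bigr => i _; rewrite !mxE mulNr.
have s2 : \sum_(i < D) (X2.2 0 i *: grad ((- X1.1) 0 i)) 0 k =
    - \sum_(i < D) X2.2 0 i * fps_partial k (X1.1 0 i).
  by rewrite -sumrN; apply: eq_bigr => i _; rewrite !mxE raddfN mulrN.
have s3 : (\row_i vderiv X2 ((- X1.2) 0 i)) 0 k =
    - \sum_(i < D) X2.1 0 i * fps_partial i (X1.2 0 k).
  by rewrite mxE -sumrN; apply: eq_bigr => i _; rewrite mxE raddfN mulrN.
have s4 : \sum_(i < D) (X2.1 0 i *: grad ((- X1.2) 0 i)) 0 k =
    - \sum_(i < D) X2.1 0 i * fps_partial k (X1.2 0 i).
  by rewrite -sumrN; apply: eq_bigr => i _; rewrite !mxE raddfN mulrN.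
rewrite s1 s2 s3 s4 oneform_comb; congr (_ - _).
  by rewrite mxE big_split.
by rewrite mxE -sumrB; apply: eq_bigr => i _; rewrite mxE mulrBr.
Qed.

Lemma state1_bigsum e (s : {fset ghost}) (I : finType) (G : I -> gsection D K) :
  state1 e s (\sum_i G i) = \sum_i state1 e s (G i).
Proof. exact: raddf_sum. Qed.

Lemma bracket_state1 X1 X2 : exists B : oneform D K,
  bracket (section_F1 X1) (section_F1 X2) =
    state1 1%N c1 (dorfman X1 X2) + state1 2%N c1 (0, B).
Proof.
rewrite /bracket !section_F1E ghost_parity_state1 bmodeN1_state1 Y_state1.
(* The 1-form corrections are chosen for all i at once, so that their sum is the witness. *)
have [B BE] := choice (fun i => pfun_field0 i ((- X1).1 0 i) 0 c1 X2).
exists (\sum_i B i); rewrite -dorfmanE.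
have -> : (0, \sum_i B i) = \sum_i (0, B i) :> gsection D K.
  apply: injective_projections; last by rewrite snd_sum.
  by rewrite fst_sum [RHS]big1.
apply: etrans (f_equal2 _ (eq_bigr _ (fun i _ => BE i))
  (eq_bigr _ (fun j _ => xfun_field0 j ((- X1).2 0 j) 0 c1 X2))) _.
rewrite [X in X + _ = _]big_split.
rewrite [X in _ = X + _]state1D.
rewrite [X in _ = X + _ + _]state1_bigsum [X in _ = _ + X + _]state1_bigsum.
rewrite [X in _ = _ + X]state1_bigsum.
exact: addrAC.
Qed.

Lemma state0_sum e (s : {fset ghost}) (I : finType) (f : I -> R) :
  state0 e s (\sum_i f i) = \sum_i state0 e s (f i).
Proof. exact: raddf_sum. Qed.

(** The single contractions of p with dX, in both orders, give the pairing. The double contractions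
    give the h^2 term, which the limit in h discards. *)
Lemma Y_section1 X1 X2 :
  Y (section_state X1) 1 (section_state X2) =
    state0 1 fset0 (- pairing X1 X2)
    + state0 2 fset0 (\sum_i vderiv (- spartial i X2) (X1.1 0 i)).
Proof.
rewrite !section_stateE Y_state1.
have pE i := pfun_field1 i (X1.1 0 i) 0 fset0 X2.
have xE j := xfun_field1 j (X1.2 0 j) 0 fset0 X2.
apply: etrans (f_equal2 _ (eq_bigr _ (fun i _ => pE i))
  (eq_bigr _ (fun j _ => xE j))) _.
rewrite [X in X + _ = _]big_split /pairing -sumrN.
rewrite [X in _ = X + _]state0_sum [X in _ = _ + X]state0_sum.
rewrite [LHS]addrAC -[X in X + _ = _]big_split; congr (_ + _).
by apply: eq_bigr => i _; rewrite opprD state0D.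
Qed.

(** This is the common end of the two claims on leading coefficients: [leading_state1] shows that a
    leading term exists, and uniqueness identifies the one selected by [xget]. *)
Lemma xget_leading_state1 (k : nat) (x : S) X X' :
    x = state1 k c1 X + state1 k.+1 c1 X' ->
  leading k x (xget 0 (leading k x)) /\ xget 0 (leading k x) = section_F1 X.
Proof.
move=> xE; have lx := leading_state1 k X X'; rewrite -xE in lx.
by rewrite (xget_leading lx) section_F1E.
Qed.

Lemma hlim_section X1 X2 :
  hlim (- hmul (- 1) (Y (section_state X1) 1 (section_state X2)))
    (fun_state (pairing X1 X2)).
Proof.
rewrite Y_section1 fun_stateE.
rewrite (etrans (hmulD _ _ _) (f_equal2 _ (hmul_state0 _ _ _ _) (hmul_state0 _ _ _ _))).
rewrite state0N oppr_add_opp -state0N.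
split; first by move=> l /msupp_state0 ->.
set w := (- \sum_i _); exists (state0 0 fset0 w).
  by move=> l /msupp_state0 ->.
by rewrite hmul_state0.
Qed.

End Main.

Theorem proposition5p3 (R : realType) (D : nat) :
  [/\ forall X1 X2 : gsection D R[i],
        leading 1 (bracket (section_F1 X1) (section_F1 X2))
          (bracket0 (section_F1 X1) (section_F1 X2)) /\
        bracket0 (section_F1 X1) (section_F1 X2)
          = section_F1 (dorfman X1 X2),
      forall (u : fps D R[i]) (X : gsection D R[i]),
        leading 0 (mu (fun_state u) (section_F1 X))
          (mu0 (fun_state u) (section_F1 X)) /\
        mu0 (fun_state u) (section_F1 X) = section_F1 (u *: X)
    & forall X1 X2 : gsection D R[i],
        hlim (- hmul (-1) (Y (section_state X1) 1 (section_state X2)))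
          (fun_state (pairing X1 X2))].
Proof.
split=> [X1 X2|u X|X1 X2].
- have [B BE] := bracket_state1 X1 X2.
  exact: xget_leading_state1 BE.
- have [B BE] := mu_state1 u X.
  exact: xget_leading_state1 BE.
exact: hlim_section.
Qed.
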